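(* Let $M$ be an $n$-dimensional smooth manifold and let $\bar g(t)$, $t\in I$ ($I$ an interval), be a Ricci flow on modified Riemann extensions over $M$; that is, a smooth family of pseudo-Riemannian metrics on $T^*M$ satisfying $\frac{\partial \bar g}{\partial t}=-2\,\overline{\mathrm{Ric}}(\bar g(t))$ and such that, for each $t\in I$, $\bar g(t)$ is the modified Riemann extension determined by some torsion-free affine connection $\nabla(t)$ on $M$ and some symmetric $(0,2)$ tensor field $c(t)$ on $M$. Then the Ricci curvature tensor $\overline{\mathrm{Ric}}(\bar g(t))$ is independent of $t$.
   Context: Let $M$ be an $n$-dimensional smooth manifold, $\nabla$ a torsion-free affine connection on $M$ with coefficients $\Gamma^l_{ij}$ in local coordinates $(x^1,\dots,x^n)$, and $c=(c_{ij})$ a symmetric $(0,2)$ tensor field on $M$. Let $(x^1,\dots,x^n,\omega_1,\dots,\omega_n)$ be the induced coordinates on the cotangent bundle $T^*M$ (the $\omega_i$ are the fibre, or ''extended'', coordinates); unstarred indices $i,j$ range over $1,\dots,n$ and refer to $x^i$, while starred indices $i^*=n+i$ range over $n+1,\dots,2n$ and refer to $\omega_i$. The modified Riemann extension determined by $(\nabla,c)$ is the pseudo-Riemannian metric $\bar g$ on $T^*M$ with local components $$\bar g_{ij}=-2\,\omega_l\Gamma^l_{ij}+c_{ij},\qquad \bar g_{ij^*}=\bar g_{j^*i}=\delta_i^j,\qquad \bar g_{i^*j^*}=0.$$ $\overline{\mathrm{Ric}}(\bar g)$ denotes the Ricci tensor of the Levi-Civita connection of $\bar g$ on the $2n$-dimensional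 manifold $T^*M$. Ricci flow on modified Riemann extensions means, in this paper, an evolution of the metric under Ricci flow on $T^*M$ such that all the metrics obtained are modified Riemann extensions. *)

(* Defs.v *)
From HB Require Import structures.
From mathcomp Require Import all_boot all_order all_algebra.
From mathcomp Require Import ring.
From mathcomp Require Import all_classical all_reals all_analysis.
Set Implicit Arguments.
Unset Strict Implicit.
Unset Printing Implicit Defensive.
Import Order.TTheory GRing.Theory Num.Theory.
Import numFieldNormedType.Exports.
Local Open Scope classical_set_scope.
Local Open Scope ring_scope.

Section Smoothness.
Context {R : realType}.

(* Used with V finite-dimensional and U open: all iterated directional
   derivatives of order at most k exist and are continuous on U. *)
Fixpoint Ck {V : normedModType R} (k : nat) (U : set V) (f : V -> R^o) : Prop :=
  (forall x, U x -> {for x, continuous f}) /\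
  (if k is k'.+1 then
     forall v, (forall x, U x -> derivable f x v) /\ Ck k' U ('D_v f)
   else True).

Definition smooth {V : normedModType R} (U : set V) (f : V -> R^o) : Prop :=
  forall k, Ck k U f.

(* Smoothness on an arbitrary subset (needed for products with a time interval
   that may contain its endpoints): f extends locally to a smooth function. *)
Definition smooth_on {V : normedModType R} (A : set V) (f : V -> R^o) : Prop :=
  forall x, A x -> exists (U : set V) (h : V -> R^o),
    [/\ open U, U x, smooth U h & forall y, A y -> U y -> f y = h y].

Definition partial {m : nat} (i : 'I_m) (f : 'rV[R]_m -> R^o) (x : 'rV[R]_m) : R :=
  'D_(delta_mx 0 i) f x.

(* Row i, column k: the derivative of the k-th component in direction i. *)
Definition jac {m p : nat} (f : 'rV[R]_m -> 'rV[R]_p) (x : 'rV[R]_m) : 'M[R]_(m, p) :=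
  \matrix_(i, k) partial i (fun y => f y 0 k) x.

(* The derivative at t of a function on I; one-sided at endpoints in I. *)
Definition derivative_within (I : set R) (f : R -> R) (t l : R) : Prop :=
  (fun s : R => (f s - f t) / (s - t)) @ within I t^' --> l.

End Smoothness.

(* param a is meant to invert chart a on chart a @` dom a; its values elsewhere
   are irrelevant. *)
Record atlas (R : realType) (n : nat) (M : Type) := Atlas {
  idx : Type;
  dom : idx -> set M;
  chart : idx -> M -> 'rV[R]_n;
  param : idx -> 'rV[R]_n -> M }.

(* Coordinate domains and the changes of coordinates between them. Tensor
   fields and connections are given by their components in each coordinate
   system, subject to the transformation laws. *)
Record coords (R : realType) (m : nat) := Coords {
  cidx : Type;
  cdom : cidx -> set 'rV[R]_m;
  overlap : cidx -> cidx -> set 'rV[R]_m;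
  trans : cidx -> cidx -> 'rV[R]_m -> 'rV[R]_m }.

Definition coords_of {R : realType} {n : nat} {M : Type} (A : atlas R n M) : coords R n :=
  @Coords R n (idx A)
    (fun a => chart a @` dom a)
    (fun a b => chart a @` (dom a `&` dom b))
    (fun a b => chart b \o param a).

Definition smooth_manifold {R : realType} {n : nat} {M : topologicalType}
    (A : atlas R n M) : Prop :=
  [/\ hausdorff_space M, @second_countable M,
      forall p, exists a : idx A, dom a p,
      forall a : idx A,
        [/\ open (dom a), open (chart a @` dom a),
            forall p, dom a p -> param a (chart a p) = p,
            {within dom a, continuous (chart a)} &
            {within chart a @` dom a, continuous (@param R n M A a)}] &
      forall (a b : cidx (coords_of A)) (k : 'I_n),
        smooth (overlap a b) (fun x => trans a b x 0 k)].

(* The induced coordinates (x, w) on the cotangent bundle, as row_mx x w. If y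
   is the change of coordinates on the base, the fibre coordinates change by
   w_i = \sum_k (d y^k / d x^i) w'_k. *)
Definition cotangent {R : realType} {n : nat} (X : coords R n) : coords R (n + n) :=
  @Coords R (n + n) (cidx X)
    (fun a => [set z | cdom a (lsubmx z)])
    (fun a b => [set z | overlap a b (lsubmx z)])
    (fun a b z => row_mx (trans a b (lsubmx z))
       (rsubmx z *m (invmx (jac (trans a b) (lsubmx z)))^T)).

Section Tensors.
Context {R : realType} {m : nat} (X : coords R m).

Definition components02 := forall a : cidx X, 'rV[R]_m -> 'M[R]_m.

Definition tensor02 (T : components02) : Prop :=
  (forall a i j, smooth (cdom a) (fun x => T a x i j)) /\
  (forall a b x, overlap a b x ->
     T a x = jac (trans a b) x *m T b (trans a b x) *m (jac (trans a b) x)^T).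

Definition symmetric02 (T : components02) : Prop :=
  forall a x, cdom a x -> (T a x)^T = T a x.

Definition pseudo_riemannian (g : components02) : Prop :=
  [/\ tensor02 g, symmetric02 g &
      forall a x, cdom a x -> g a x \in unitmx].

(* G a x l i j is the coefficient with upper index l and lower indices i, j. *)
Definition coefficients := forall a : cidx X, 'rV[R]_m -> 'I_m -> 'I_m -> 'I_m -> R.

Definition affine_connection (G : coefficients) : Prop :=
  (forall a l i j, smooth (cdom a) (fun x => G a x l i j)) /\
  (forall a b x, overlap a b x -> forall k i j,
     let J := jac (trans a b) x in
     \sum_l G a x l i j * J l k =
       partial i (partial j (fun u => trans a b u 0 k)) x +
       \sum_p \sum_q G b (trans a b x) k p q * J i p * J j q).

Definition torsion_free (G : coefficients) : Prop :=
  forall a x, cdom a x -> forall l i j, G a x l i j = G a x l j i.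

Definition metric_compatible (g : components02) (G : coefficients) : Prop :=
  forall a x, cdom a x -> forall i j k,
    partial k (fun u => g a u i j) x =
      \sum_l (G a x l k i * g a x l j + G a x l k j * g a x i l).

(* By the three lemmas at the end of the file, for a pseudo-Riemannian g these
   are the unique torsion-free coefficients compatible with g. *)
Definition levi_civita (g : components02) : coefficients := fun a x l i j =>
  2^-1 * \sum_d invmx (g a x) l d *
    (partial i (fun u => g a u d j) x + partial j (fun u => g a u i d) x
     - partial d (fun u => g a u i j) x).

(* The d/dx^l component of R(d/dx^i, d/dx^j) d/dx^k. *)
Definition curvature (G : coefficients) (a : cidx X) (x : 'rV[R]_m)
    (l k i j : 'I_m) : R :=
  partial i (fun u => G a u l j k) x - partial j (fun u => G a u l i k) x
  + \sum_p (G a x l i p * G a x p j k - G a x l j p * G a x p i k).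

Definition ricci_of (G : coefficients) : components02 := fun a x =>
  \matrix_(j, k) \sum_i curvature G a x i k i j.

Definition ricci (g : components02) : components02 := ricci_of (levi_civita g).

Definition smooth_family (I : set R) (g : R -> components02) : Prop :=
  forall a i j, smooth_on (I `*` cdom a : set (R^o * 'rV[R]_m)%type)
    (fun p => g p.1 a p.2 i j).

Definition ricci_flow (I : set R) (g : R -> components02) : Prop :=
  [/\ forall t, I t -> pseudo_riemannian (g t),
      smooth_family I g &
      forall t, I t -> forall a x, cdom a x -> forall i j,
        derivative_within I (fun s => g s a x i j) t (- 2 * ricci (g t) a x i j)].

End Tensors.

Definition modified_riemann_extension {R : realType} {n : nat} (X : coords R n)
    (G : coefficients X) (c : components02 X) : components02 (cotangent X) :=
  fun a z => let x := lsubmx z in let w := rsubmx z in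
    block_mx (\matrix_(i, j) (- 2 * (\sum_l w 0 l * G a x l i j) + c a x i j)) 1%:M
             1%:M 0.

Definition is_modified_riemann_extension {R : realType} {n : nat} (X : coords R n)
    (g : components02 (cotangent X)) : Prop :=
  exists (G : coefficients X) (c : components02 X),
    [/\ affine_connection G, torsion_free G, tensor02 c, symmetric02 c &
        forall (a : cidx (cotangent X)) z, cdom a z ->
          g a z = modified_riemann_extension G c a z].

Section LeviCivita.
Context {R : realType} {m : nat} (X : coords R m).
Context (cdom_open : forall a : cidx X, open (cdom a)).
Context (g : components02 X).
Context (g_sym : symmetric02 g)
  (g_unit : forall a x, cdom a x -> g a x \in unitmx).

Let gC a x i j : cdom a x -> g a x i j = g a x j i.
Proof. by move=> ax; rewrite -{1}(g_sym ax) mxE. Qed.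

Let dgC a x i j k : cdom a x ->
  partial k (fun u => g a u i j) x = partial k (fun u => g a u j i) x.
Proof.
move=> ax; rewrite /partial.
apply: near_eq_derive.
have : nbhs x (cdom a) by exact: open_nbhs_nbhs.
by apply: filterS => y ay; exact: gC.
Qed.

Let lower a x j (F : 'I_m -> R) : cdom a x ->
  \sum_l g a x j l * (2^-1 * \sum_d invmx (g a x) l d * F d) = 2^-1 * F j.
Proof.
move=> ax; under eq_bigr do rewrite mulrCA.
rewrite -mulr_sumr; congr (_ * _).
under eq_bigr do rewrite mulr_sumr.
rewrite exchange_big /=.
transitivity (\sum_d (g a x *m invmx (g a x)) j d * F d).
  apply: eq_bigr => d _; rewrite mxE mulr_suml.
  by apply: eq_bigr => l _; rewrite mulrA.
rewrite mulmxV ?g_unit// (bigD1 j)//= mxE eqxx mul1r big1 ?addr0// => d dj.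
by rewrite mxE eq_sym (negbTE dj) mul0r.
Qed.

Let raise a x l (H : 'I_m -> R) : cdom a x ->
  \sum_d invmx (g a x) l d * (\sum_p g a x d p * H p) = H l.
Proof.
move=> ax; under eq_bigr do rewrite mulr_sumr.
rewrite exchange_big /=.
transitivity (\sum_p (invmx (g a x) *m g a x) l p * H p).
  apply: eq_bigr => d _; rewrite mxE mulr_suml.
  by apply: eq_bigr => p _; rewrite mulrA.
rewrite mulVmx ?g_unit// (bigD1 l)//= mxE eqxx mul1r big1 ?addr0// => d dl.
by rewrite mxE eq_sym (negbTE dl) mul0r.
Qed.

Lemma levi_civita_torsion_free : torsion_free (levi_civita g).
Proof.
move=> a x ax l i j; rewrite /levi_civita; congr (_ * _).
apply: eq_bigr => d _; congr (_ * _).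
by rewrite (dgC i j d ax) (dgC d i j ax) (dgC j d i ax) (addrC (partial i _ x)).
Qed.

Lemma levi_civita_compatible : metric_compatible g (levi_civita g).
Proof.
move=> a x ax i j k; rewrite big_split /=.
have e1 : \sum_l levi_civita g a x l k i * g a x l j =
    \sum_l g a x j l * levi_civita g a x l k i.
  by apply: eq_bigr => l _; rewrite mulrC (gC l j ax).
have e2 : \sum_l levi_civita g a x l k j * g a x i l =
    \sum_l g a x i l * levi_civita g a x l k j.
  by apply: eq_bigr => l _; rewrite mulrC.
rewrite e1 e2 /levi_civita !lower//.
rewrite (dgC j i k ax); by field.
Qed.

Lemma levi_civita_unique (G : coefficients X) :
  torsion_free G -> metric_compatible g G ->
  forall a x, cdom a x -> forall l i j, G a x l i j = levi_civita g a x l i j.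
Proof.
move=> tf mc a x ax l i j; rewrite /levi_civita.
pose S d p q := \sum_l g a x d l * G a x l p q.
have SC d p q : S d p q = S d q p.
  by apply: eq_bigr => r _; rewrite (tf _ _ ax r p q).
have dS p q k : partial k (fun u => g a u p q) x = S q k p + S p k q.
  rewrite (mc _ _ ax) big_split /=; congr (_ + _); apply: eq_bigr => r _.
    by rewrite mulrC (gC r q ax).
  by rewrite mulrC.
under eq_bigr => d _.
  rewrite !dS (SC j i d) (SC i j d) (SC d j i).
  have -> : S j d i + S d i j + (S d i j + S i d j) - (S j d i + S i d j)
    = 2 * S d i j by ring.
  rewrite mulrCA; over.
by rewrite -mulr_sumr raise// mulrA mulVf ?mul1r// pnatr_eq0.
Qed.

End LeviCivita.

(* Main.v *)
Require Import Defs.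
From mathcomp Require Import all_boot all_order all_algebra.
From mathcomp Require Import all_classical all_reals all_analysis.
From mathcomp Require Import ring.
Import Order.TTheory GRing.Theory Num.Theory.
Import numFieldNormedType.Exports.

(** A modified Riemann extension has matrix [[A, 1], [1, 0]] with
    A_ij = -2 w_l G^l_ij + c_ij affine in the fibre coordinates w, and inverse
    [[0, 1], [1, -A]].  Writing i' for the fibre index dual to the base index i,
    the Levi-Civita coefficients are: G^l_ij with upper index l and lower indices
    i, j; - G^j_il with upper index l' and lower indices i, j' or j', i; an
    expression affine in w, christoffel_fibre, with upper index l' and lower
    indices i, j; and 0 otherwise.  With R the curvature of the connection on the
    base and bar R that of the extension, the components whose traces make up
    the Ricci tensor are then
      bar R^l_(k i j) = R^l_(k i j)   and   bar R^l'_(k i' j) = R^i_(j l k)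
    (curvature_extension_base and curvature_extension_fibre), so that the Ricci
    tensor of the extension is the symmetrisation P + P^T of the Ricci tensor P
    of G in the base directions and 0 in all others (ricci_extension).  It
    involves neither c nor w.

    Along the flow the time derivative of A_ij is therefore the same at every
    point of a fibre.  So the difference of the values of A_ij at two points of
    the same fibre does not depend on t; but for the points with fibre
    coordinates the l-th unit vector and 0 this difference is -2 G^l_ij.  The
    connection is thus constant in time, and with it the Ricci tensor, which is
    computed from the connection alone (ricci_flow_extension_stationary). *)

(** * Derivatives relative to an interval *)

Section DerivativeWithin.
Local Open Scope classical_set_scope.
Local Open Scope ring_scope.
Context {R : realType}.

Lemma derivative_within_sub (I : set R) (f g : R -> R) (t l k : R) :
  derivative_within I f t l -> derivative_within I g t k ->
  derivative_within I (fun s => f s - g s) t (l - k).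
Proof.
move=> df dg; rewrite /derivative_within.
have -> : (fun s : R => (f s - g s - (f t - g t)) / (s - t)) =
   (fun s : R => (f s - f t) / (s - t)) \- (fun s : R => (g s - g t) / (s - t)).
  apply: funext => s /=; ring.
exact: cvgB.
Qed.

(** At an interior point the derivative within I is the ordinary derivative, in
    the form that the mean value theorem takes. *)
Lemma derivative_within_is_derive (I : set R) (f : R -> R) (t l : R) :
  nbhs t I -> derivative_within I f t l -> is_derive (t : R^o) 1 (f : R^o -> R^o) l.
Proof.
move=> It df.
have cv : (fun h : R => h^-1 *: ((f \o shift t) (h *: (1 : R^o)) - f t)) @ 0^' --> l.
  apply/cvgrPdist_lt => e e0.
  move/cvgrPdist_lt: df => /(_ e e0); rewrite near_withinE => df.
  have {It df} : \forall s \near t^', `|l - (f s - f t) / (s - t)| < e.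
    near=> s; suff : I s by near: s.
    by near: s; exact: nbhs_dnbhs.
  rewrite -!nbhs_nearE.
  case/nbhs_ballP => d /= d0 H; apply/nbhs_ballP; exists d => //= h hd h0.
  have /= := H (h + t); rewrite /ball /= in hd *.
  rewrite addrK opprD addrCA subrr addr0 => /(_ _ _).
  rewrite /= /GRing.scale /= mulr1 [h^-1 * _]mulrC; apply.
    by rewrite -normrN opprK -[h]subr0 -normrN opprB.
  by rewrite -subr_eq0 addrK.
apply: DeriveDef; first by apply/cvg_ex; exists l.
exact/cvg_lim.
Unshelve. all: by end_near. Qed.

(** Continuity relative to I holds at the endpoints too, because the difference
    quotient is bounded by |l| + 1 near t. *)
Lemma derivative_within_continuous (I : set R) (f : R -> R) (t l : R) :
  derivative_within I f t l -> f @ within I (nbhs t) --> f t.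
Proof.
move=> df; apply/cvgrPdist_lt => e e0.
have {df} : \forall s \near t, I s -> `|f s - f t| <= (`|l| + 1) * `|s - t|.
  move/cvgrPdist_lt: df => /(_ 1 ltr01); rewrite !near_withinE.
  apply: filterS => s H Is.
  have [->|st] := eqVneq s t; first by rewrite !subrr normr0 mulr0.
  have {}H := H st Is.
  have nst : 0 < `|s - t| by rewrite normr_gt0 subr_eq0.
  rewrite -ler_pdivrMr// -normfV -normrM.
  set q := (_ / _) in H *.
  rewrite -[q](subKr l) (le_trans (ler_normB _ _))// lerD2l ltW//.
rewrite near_withinE.
have l0 : 0 < `|l| + 1 by rewrite ltr_wpDl.
have : \forall s \near t, `|s - t| < e / (`|l| + 1).
  apply/nbhs_ballP; exists (e / (`|l| + 1)); first by rewrite /= divr_gt0.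
  by move=> s; rewrite /ball /= distrC.
apply: filterS2 => s st df Is; rewrite distrC (le_lt_trans (df Is))//.
by rewrite mulrC -ltr_pdivlMr.
Qed.

Lemma derivative_within_eq0_cst (I : set R) (f : R -> R) :
  is_interval I -> (forall t, I t -> derivative_within I f t 0) ->
  forall s t, I s -> I t -> f s = f t.
Proof.
move=> itvI df s t; wlog st : s t / s <= t.
  by move=> H Is It; case: (leP s t) => [|/ltW] ? ; [|apply: esym]; exact: H.
move=> Is It; apply/esym/eqP; rewrite -subr_eq0; apply/eqP.
have sub x : x \in `[s, t] -> I x by rewrite in_itv /= => /(itvI s t Is It).
have der x : x \in `]s, t[ -> is_derive (x : R^o) 1 (f : R^o -> R^o) 0.
  move=> xst; apply: (@derivative_within_is_derive I); last first.
    exact/df/sub/subset_itv_oo_cc.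
  by apply: filterS (near_in_itvoo xst) => y /subset_itv_oo_cc/sub.
have cont : {within `[s, t], continuous f}.
  apply/subspace_continuousP => x xst.
  apply: cvg_trans (derivative_within_continuous _ _ _ _ (df x (sub x xst))).
  by apply: cvg_app; apply: within_subset => y /sub.
by have [x _ ->] := MVT_segment st der cont; rewrite mul0r.
Qed.

End DerivativeWithin.

(** * Locality of partial derivatives *)

Section Slices.
Local Open Scope classical_set_scope.
Local Open Scope ring_scope.
Context {R : realType}.

(** Fibre derivatives are all computed with this criterion: the coefficients of
    the extension are affine in the fibre coordinates, so no limit is needed. *)
Lemma partial_affine (m : nat) (k : 'I_m) (f : 'rV[R]_m -> R^o) x (b : R) :
  (forall h : R, f (h *: delta_mx 0 k + x) = f x + h * b) -> partial k f x = b.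
Proof.
move=> fE; rewrite /partial /derive; apply/cvg_lim => //.
apply: cvg_near_cst; rewrite near_withinE.
apply: nearW => h /= h0; rewrite /shift /= fE addrAC subrr add0r.
by rewrite /GRing.scale /= mulKf.
Qed.

Lemma partial_near (m : nat) (k : 'I_m) (U : set 'rV[R]_m) (f g : 'rV[R]_m -> R^o) x :
  open U -> U x -> (forall u, U u -> f u = g u) -> partial k f x = partial k g x.
Proof.
move=> oU Ux fg; apply: near_eq_derive.
have := open_nbhs_nbhs (conj oU Ux); exact: filterS.
Qed.

(** A partial derivative only sees the values on a line, hence on a slice;
    base and fibre derivatives can thus be taken separately. *)
Lemma partial_lshift (p q : nat) (k : 'I_p) (f : 'rV[R]_(p + q) -> R^o) x w :
  partial (lshift q k) f (row_mx x w) = partial k (fun u => f (row_mx u w)) x.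
Proof.
have E (h : R) : h *: delta_mx 0 (lshift q k) + row_mx x w = row_mx (h *: delta_mx 0 k + x) w.
  apply/rowP => i; rewrite !mxE.
  by case: split_ordP => j ->; rewrite ?mxE ?eq_lshift // eq_rlshift andbF mulr0 add0r.
by rewrite /partial /derive /shift /=; under eq_fun do rewrite E.
Qed.

Lemma partial_rshift (p q : nat) (k : 'I_q) (f : 'rV[R]_(p + q) -> R^o) x w :
  partial (rshift p k) f (row_mx x w) = partial k (fun u => f (row_mx x u)) w.
Proof.
have E (h : R) : h *: delta_mx 0 (rshift p k) + row_mx x w = row_mx x (h *: delta_mx 0 k + w).
  apply/rowP => i; rewrite !mxE.
  by case: split_ordP => j ->; rewrite ?mxE ?eq_rshift // eq_lrshift andbF mulr0 add0r.
by rewrite /partial /derive /shift /=; under eq_fun do rewrite E.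
Qed.

Lemma smooth_derivable (V : normedModType R) (U : set V) (f : V -> R^o) x v :
  smooth U f -> U x -> derivable f x v.
Proof. by move=> /(_ 1%N)[_ /(_ v)[+ _]] => /(_ x). Qed.

Lemma ricci_of_local (m : nat) (Y : coords R m) (G H : coefficients Y) (a : cidx Y) :
  open (cdom a) -> (forall x, cdom a x -> forall l i j, G a x l i j = H a x l i j) ->
  forall x, cdom a x -> ricci_of G a x = ricci_of H a x.
Proof.
move=> oa GH x ax; have dGH k l i j :
    partial k (fun u => G a u l i j) x = partial k (fun u => H a u l i j) x.
  by apply: (partial_near _ _ (cdom a)) => // u au; exact: GH.
apply/matrixP => j k; rewrite !mxE; apply: eq_bigr => i _.
rewrite /curvature !dGH; congr (_ + _).
by apply: eq_bigr => p _; rewrite !GH.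
Qed.

End Slices.

(** * The Ricci tensor of a modified Riemann extension *)

Section RicciExtension.
Local Open Scope classical_set_scope.
Local Open Scope ring_scope.
Context {R : realType} {n : nat} {X : coords R n}.
Context (G : coefficients X) (c : components02 X) (g : components02 (cotangent X)).
Context (openX : forall a : cidx X, open (cdom a)).
Context (dG : forall a x l i j v, cdom a x -> derivable ((fun u => G a u l i j) : _ -> R^o) x v).
Context (dc : forall a x i j v, cdom a x -> derivable ((fun u => c a u i j) : _ -> R^o) x v).
Context (tfG : torsion_free G).
Context (gE : forall (a : cidx (cotangent X)) z, cdom a z ->
          g a z = modified_riemann_extension G c a z).
Variable a : cidx X.
Implicit Types (x w : 'rV[R]_n) (i j k l : 'I_n).

(** Locked because comparing two partial derivatives in distinct directions by
    conversion unfolds the whole theory of limits before it fails. *)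
Definition dconn : 'rV[R]_n -> 'I_n -> 'I_n -> 'I_n -> 'I_n -> R :=
  locked (fun x k l i j => partial k (fun u => G a u l i j) x).

Lemma dconnE x k l i j : dconn x k l i j = partial k (fun u => G a u l i j) x.
Proof. by rewrite /dconn -lock. Qed.

Lemma curvature_dconn x l k i j : curvature G a x l k i j =
  dconn x i l j k - dconn x j l i k
  + \sum_p (G a x l i p * G a x p j k - G a x l j p * G a x p i k).
Proof. by rewrite !dconnE. Qed.

Definition base_block x w : 'M[R]_n :=
  \matrix_(i, j) (- 2 * (\sum_l w 0 l * G a x l i j) + c a x i j).

(** Locked for the same reason as dconn. *)
Definition dbase_block : 'rV[R]_n -> 'rV[R]_n -> 'I_n -> 'M[R]_n :=
  locked (fun x w k => \matrix_(i, j)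
    (- 2 * (\sum_l w 0 l * dconn x k l i j)
     + partial k (fun u => c a u i j) x)).

Lemma dbase_blockE x w k i j : dbase_block x w k i j =
  - 2 * (\sum_l w 0 l * dconn x k l i j)
  + partial k (fun u => c a u i j) x.
Proof. by rewrite /dbase_block -lock mxE. Qed.

Lemma extension_row_mx x w : cdom a x ->
  g a (row_mx x w) = block_mx (base_block x w) 1%:M 1%:M 0.
Proof.
by move=> ax; rewrite gE /= ?row_mxKl// /modified_riemann_extension row_mxKl row_mxKr.
Qed.

Lemma partial_base (f : 'rV[R]_(n + n) -> R^o) (F : 'rV[R]_n -> R^o) x w k :
  cdom a x -> (forall u, cdom a u -> f (row_mx u w) = F u) ->
  partial (lshift n k) f (row_mx x w) = partial k F x.
Proof. by move=> ax fF; rewrite partial_lshift; exact: partial_near (openX a) ax fF. Qed.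

Lemma partial_fibre (f : 'rV[R]_(n + n) -> R^o) (b : R) x w k :
  (forall h : R, f (row_mx x (h *: delta_mx 0 k + w)) = f (row_mx x w) + h * b) ->
  partial (rshift n k) f (row_mx x w) = b.
Proof. by move=> fb; rewrite partial_rshift; exact: partial_affine fb. Qed.

Lemma partial_base_block x w k i j : cdom a x ->
  partial k (fun u => base_block u w i j) x = dbase_block x w k i j.
Proof.
move=> ax; rewrite dbase_blockE.
pose S : 'rV[R]_n -> R^o := \sum_(l < n) (w 0 l \*: ((fun u => G a u l i j) : _ -> R^o)).
have dS l v : derivable (w 0 l \*: ((fun u => G a u l i j) : _ -> R^o)) x v.
  by apply: derivableZ; exact: dG.
rewrite (_ : (fun _ => _) = ((-2) \*: S) + ((fun u => c a u i j) : _ -> R^o)); last first.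
  apply: funext => u; rewrite mxE /S /= fctE; congr (_ * _ + _).
  by rewrite fct_sumE.
rewrite /partial deriveD; [|apply: derivableZ; exact: derivable_sum|exact: dc].
rewrite deriveZ; last exact: derivable_sum.
rewrite derive_sum//; congr (_ * _ + _).
by apply: eq_bigr => l _; rewrite dconnE deriveZ//; exact: dG.
Qed.

Lemma sum_fibre_step w k (h : R) (F : 'I_n -> R) :
  \sum_l (h *: delta_mx 0 k + w) 0 l * F l = \sum_l w 0 l * F l + h * F k.
Proof.
under eq_bigr do rewrite !mxE eqxx /= mulrDl.
rewrite big_split /= addrC; congr (_ + _).
rewrite (bigD1 k)//= eqxx mulr1 big1 ?addr0// => l lk.
by rewrite (negbTE lk) mulr0 mul0r.
Qed.

Lemma base_block_fibre_step x w k (h : R) i j :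
  base_block x (h *: delta_mx 0 k + w) i j = base_block x w i j + h * (- 2 * G a x k i j).
Proof. by rewrite !mxE sum_fibre_step; ring. Qed.

Lemma dbase_block_fibre_step x w k (h : R) l i j :
  dbase_block x (h *: delta_mx 0 k + w) l i j =
  dbase_block x w l i j + h * (- 2 * dconn x l k i j).
Proof. by rewrite !dbase_blockE sum_fibre_step; ring. Qed.

Lemma partial_extension_base x w k (I J : 'I_(n + n)) : cdom a x ->
  partial (lshift n k) (fun z => g a z I J) (row_mx x w) =
  block_mx (dbase_block x w k) 0 0 0 I J.
Proof.
move=> ax.
rewrite (@partial_base _ (fun u => block_mx (base_block u w) 1%:M 1%:M 0 I J))//; last first.
  by move=> u au; rewrite extension_row_mx.
case: (split_ordP I) => i ->; case: (split_ordP J) => j ->.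
- rewrite [RHS]block_mxEul -partial_base_block//; congr partial.
  by apply: funext => u; rewrite block_mxEul.
- rewrite [RHS]block_mxEur mxE; apply: partial_affine => h.
  by rewrite !block_mxEur mulr0 addr0.
- rewrite [RHS]block_mxEdl mxE; apply: partial_affine => h.
  by rewrite !block_mxEdl mulr0 addr0.
- rewrite [RHS]block_mxEdr mxE; apply: partial_affine => h.
  by rewrite !block_mxEdr mulr0 addr0.
Qed.

Lemma partial_extension_fibre x w k (I J : 'I_(n + n)) : cdom a x ->
  partial (rshift n k) (fun z => g a z I J) (row_mx x w) =
  block_mx (\matrix_(i, j) (- 2 * G a x k i j)) 0 0 0 I J.
Proof.
move=> ax; apply: partial_fibre => h; rewrite !extension_row_mx//.
case: (split_ordP I) => i ->; case: (split_ordP J) => j ->.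
- by rewrite !block_mxEul base_block_fibre_step [X in _ = _ + h * X]mxE.
- by rewrite !block_mxEur [X in _ = _ + h * X]mxE mulr0 addr0.
- by rewrite !block_mxEdl [X in _ = _ + h * X]mxE mulr0 addr0.
- by rewrite !block_mxEdr [X in _ = _ + h * X]mxE mulr0 addr0.
Qed.

Lemma invmx_extension x w : cdom a x ->
  invmx (g a (row_mx x w)) = block_mx 0 1%:M 1%:M (- base_block x w).
Proof.
move=> ax; rewrite extension_row_mx//.
set A := block_mx _ _ _ 0; set B := block_mx 0 _ _ _.
have AB : A *m B = 1%:M.
  rewrite mulmx_block !mulmx0 !mulmx1 !mul1mx !mul0mx !add0r !addr0 subrr.
  by rewrite -scalar_mx_block.
by rewrite -[RHS]mul1mx -(mulVmx (mulmx1_unit AB).1) -mulmxA AB mulmx1.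
Qed.

(** Christoffel symbol of the first kind, K being the lowered index; for K a fibre
    index it is already a base coefficient, since the metric pairs fibre and base
    directions by the identity. *)
Definition christoffel_first_kind x w (I J K : 'I_(n + n)) : R := 2^-1 *
  (partial I (fun z => g a z K J) (row_mx x w) + partial J (fun z => g a z I K) (row_mx x w)
   - partial K (fun z => g a z I J) (row_mx x w)).

Lemma levi_civitaE x w L I J : levi_civita g a (row_mx x w) L I J =
  \sum_K invmx (g a (row_mx x w)) L K * christoffel_first_kind x w I J K.
Proof. by rewrite /levi_civita mulr_sumr; apply: eq_bigr => K _; rewrite mulrCA. Qed.

Lemma christoffel_first_kind_fibre x w l (I J : 'I_(n + n)) : cdom a x ->
  christoffel_first_kind x w I J (rshift n l) = block_mx (\matrix_(i, j) G a x l i j) 0 0 0 I J.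
Proof.
move=> ax.
have dgb k I' J' := partial_extension_base x w k I' J' ax.
have dgf k I' J' := partial_extension_fibre x w k I' J' ax.
rewrite /christoffel_first_kind dgf.
case: (split_ordP I) => i ->; case: (split_ordP J) => j ->;
  rewrite !(dgb, dgf)
    ?(block_mxEul, block_mxEur, block_mxEdl, block_mxEdr) ?[in RHS]mxE
    ?[in LHS]mxE; by field.
Qed.

Lemma christoffel_first_kind_base x w l (I J : 'I_(n + n)) : cdom a x ->
  christoffel_first_kind x w I J (lshift n l) = block_mx
    (\matrix_(i, j) (2^-1 *
       (dbase_block x w i l j + dbase_block x w j i l - dbase_block x w l i j)))
    (\matrix_(i, j) (- G a x j i l)) (\matrix_(i, j) (- G a x i j l)) 0 I J.
Proof.
move=> ax.
have dgb k I' J' := partial_extension_base x w k I' J' ax.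
have dgf k I' J' := partial_extension_fibre x w k I' J' ax.
rewrite /christoffel_first_kind dgb.
case: (split_ordP I) => i ->; case: (split_ordP J) => j ->.
- by rewrite !dgb !block_mxEul [in RHS]mxE.
- rewrite dgb dgf !block_mxEul !block_mxEur.
  by rewrite !mxE; field.
- rewrite dgb dgf !block_mxEul !block_mxEdl.
  rewrite !mxE (tfG _ _ ax i l j).
  by field.
- rewrite !dgf !block_mxEdl !block_mxEdr !block_mxEur.
  by rewrite !mxE; field.
Qed.

Lemma sum_row1 (F : 'I_n -> R) l : \sum_d (1%:M : 'M[R]_n) l d * F d = F l.
Proof.
rewrite (bigD1 l)//= mxE eqxx mul1r big1 ?addr0// => d dl.
by rewrite mxE eq_sym (negbTE dl) mul0r.
Qed.

Lemma levi_civita_base x w l (I J : 'I_(n + n)) : cdom a x ->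
  levi_civita g a (row_mx x w) (lshift n l) I J =
  block_mx (\matrix_(i, j) G a x l i j) 0 0 0 I J.
Proof.
move=> ax; rewrite levi_civitaE invmx_extension// big_split_ord /=.
rewrite big1 ?add0r; last by move=> d _; rewrite block_mxEul mxE mul0r.
under eq_bigr do rewrite block_mxEur.
by rewrite sum_row1 christoffel_first_kind_fibre.
Qed.

(** The Levi-Civita coefficient with upper index l' and base lower indices. *)
Definition christoffel_fibre x w l i j : R :=
  2^-1 * (dbase_block x w i l j + dbase_block x w j i l - dbase_block x w l i j)
  - \sum_d base_block x w l d * G a x d i j.

Lemma levi_civita_fibre x w l (I J : 'I_(n + n)) : cdom a x ->
  levi_civita g a (row_mx x w) (rshift n l) I J =
  block_mx (\matrix_(i, j) christoffel_fibre x w l i j)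
           (\matrix_(i, j) (- G a x j i l)) (\matrix_(i, j) (- G a x i j l)) 0 I J.
Proof.
move=> ax; rewrite levi_civitaE invmx_extension// big_split_ord /=.
under eq_bigr do rewrite block_mxEdl.
under [X in _ + X]eq_bigr do rewrite block_mxEdr mxE christoffel_first_kind_fibre// mulNr.
rewrite sum_row1 christoffel_first_kind_base// sumrN.
case: (split_ordP I) => i ->; case: (split_ordP J) => j ->.
- rewrite !block_mxEul [RHS]mxE [X in X - _]mxE; congr (_ - _).
  by apply: eq_bigr => d _; rewrite block_mxEul [X in _ * X = _]mxE.
- rewrite !block_mxEur big1 ?subr0// => d _.
  by rewrite block_mxEur [X in _ * X]mxE mulr0.
- rewrite !block_mxEdl big1 ?subr0// => d _.
  by rewrite block_mxEdl [X in _ * X]mxE mulr0.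
- rewrite !block_mxEdr big1 ?subr0// => d _.
  by rewrite block_mxEdr [X in _ * X]mxE mulr0.
Qed.

(** Only the fibre derivative of this coefficient enters the Ricci tensor; all
    terms in c disappear from it. *)
Lemma christoffel_fibre_fibre_step x w k (h : R) l i j :
  christoffel_fibre x (h *: delta_mx 0 k + w) l i j = christoffel_fibre x w l i j + h *
   (dconn x l k i j - dconn x i k l j
    - dconn x j k i l + 2 * \sum_d G a x k l d * G a x d i j).
Proof.
rewrite /christoffel_fibre !dbase_block_fibre_step.
under eq_bigr do rewrite base_block_fibre_step mulrDl.
rewrite big_split /= mulr_sumr.
rewrite (_ : \sum_d h * _ * _ = - (h * \sum_d 2 * (G a x k l d * G a x d i j))).
  by field.
by rewrite mulr_sumr -sumrN; apply: eq_bigr => d _; ring.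
Qed.

Lemma partial_levi_civita_base x w k l (I J : 'I_(n + n)) : cdom a x ->
  partial (lshift n k) (fun z => levi_civita g a z (lshift n l) I J) (row_mx x w) =
  block_mx (\matrix_(i, j) dconn x k l i j) 0 0 0 I J.
Proof.
move=> ax; rewrite (partial_base (fun z => levi_civita g a z (lshift n l) I J) _ _ _ _ ax
  (fun u => levi_civita_base u w l I J)).
case: (split_ordP I) => i ->; case: (split_ordP J) => j ->.
- rewrite block_mxEul mxE dconnE; congr (partial k _ x).
  by apply: funext => u; rewrite block_mxEul mxE.
- rewrite block_mxEur mxE; apply: partial_affine => h.
  by rewrite !block_mxEur !mxE mulr0 addr0.
- rewrite block_mxEdl mxE; apply: partial_affine => h.
  by rewrite !block_mxEdl !mxE mulr0 addr0.
- rewrite block_mxEdr mxE; apply: partial_affine => h.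
  by rewrite !block_mxEdr !mxE mulr0 addr0.
Qed.

Lemma partial_fibre_levi_civita_base x w k l (I J : 'I_(n + n)) : cdom a x ->
  partial (rshift n k) (fun z => levi_civita g a z (lshift n l) I J) (row_mx x w) = 0.
Proof.
by move=> ax; apply: partial_fibre => h; rewrite !levi_civita_base// mulr0 addr0.
Qed.

Lemma partial_levi_civita_fibre_lower x w k l i (J : 'I_(n + n)) : cdom a x ->
  partial (lshift n k) (fun z => levi_civita g a z (rshift n l) (rshift n i) J)
    (row_mx x w) =
  row_mx (\row_j (- dconn x k i j l)) 0 0 J.
Proof.
move=> ax; rewrite (partial_base (fun z => levi_civita g a z (rshift n l) (rshift n i) J) _ _ _ _ ax
  (fun u => levi_civita_fibre u w l _ J)).
case: (split_ordP J) => j ->.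
- rewrite row_mxEl mxE dconnE; transitivity (partial k (fun u => - G a u i j l) x).
    by congr (partial k _ x); apply: funext => u; rewrite block_mxEdl mxE.
  by apply: deriveN; exact: dG.
- rewrite row_mxEr mxE; apply: partial_affine => h.
  by rewrite !block_mxEdr !mxE mulr0 addr0.
Qed.

Lemma partial_fibre_levi_civita_fibre x w k l (I J : 'I_(n + n)) : cdom a x ->
  partial (rshift n k) (fun z => levi_civita g a z (rshift n l) I J) (row_mx x w) =
  block_mx (\matrix_(i, j)
   (dconn x l k i j - dconn x i k l j
    - dconn x j k i l + 2 * \sum_d G a x k l d * G a x d i j))
   0 0 0 I J.
Proof.
move=> ax; apply: partial_fibre => h; rewrite !levi_civita_fibre//.
case: (split_ordP I) => i ->; case: (split_ordP J) => j ->.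
- by rewrite !block_mxEul !mxE christoffel_fibre_fibre_step.
- by rewrite !block_mxEur !mxE mulr0 addr0.
- by rewrite !block_mxEdl !mxE mulr0 addr0.
- by rewrite !block_mxEdr !mxE mulr0 addr0.
Qed.

Lemma curvature_extension_base x w l i (J K : 'I_(n + n)) : cdom a x ->
  curvature (levi_civita g) a (row_mx x w) (lshift n l) K (lshift n i) J =
  block_mx (\matrix_(j, k) curvature G a x l k i j) 0 0 0 J K.
Proof.
move=> ax; rewrite [LHS]/curvature big_split_ord /= partial_levi_civita_base//.
under eq_bigr do rewrite !levi_civita_base// block_mxEul mxE.
rewrite [X in _ + (_ + X)]big1 ?addr0; last first.
  move=> p _; rewrite !levi_civita_base// block_mxEur mxE mul0r.
  by case: (split_ordP J) => j ->; rewrite ?block_mxEur ?block_mxEdr mxE mul0r subr0.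
case: (split_ordP J) => j ->; case: (split_ordP K) => k ->;
  rewrite (partial_levi_civita_base, partial_fibre_levi_civita_base)//.
- rewrite !block_mxEul !mxE curvature_dconn; congr (_ + _).
  by apply: eq_bigr => p _; rewrite !block_mxEul !mxE.
- rewrite !block_mxEur !mxE subrr add0r big1// => p _.
  by rewrite !block_mxEur !block_mxEul !mxE !mulr0 subr0.
- rewrite !block_mxEdl !mxE subrr add0r big1// => p _.
  by rewrite !block_mxEdl !block_mxEul !mxE mulr0 mul0r subr0.
- rewrite !block_mxEdr !mxE subrr add0r big1// => p _.
  by rewrite !block_mxEdr !block_mxEdl !block_mxEur !mxE mulr0 mul0r subr0.
Qed.

Lemma dconn_torsion_free x k l i j : cdom a x ->
  dconn x k l i j = dconn x k l j i.
Proof.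
by move=> ax; rewrite !dconnE; apply: (partial_near _ _ (cdom a)) => // u au; exact: tfG.
Qed.

(** The curvature of the cotangent lift is dual to that of the base connection.
    The term - d_j G^i_lk of the fibre derivative of christoffel_fibre is
    cancelled by the derivative of the coefficient - G^i_kl in direction j, and
    of its quadratic terms 2 G^i_ld G^d_jk one copy is cancelled by the
    contraction of - G^i_pl with G^p_jk. *)
Lemma curvature_extension_fibre x w l i (J K : 'I_(n + n)) : cdom a x ->
  curvature (levi_civita g) a (row_mx x w) (rshift n l) K (rshift n i) J =
  block_mx (\matrix_(j, k) curvature G a x i j l k) 0 0 0 J K.
Proof.
move=> ax; rewrite [LHS]/curvature big_split_ord /= partial_fibre_levi_civita_fibre//.
under eq_bigr do rewrite !levi_civita_fibre// !levi_civita_base// block_mxEdl mxE.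
under [X in _ + (_ + X)]eq_bigr do
  rewrite !levi_civita_fibre// block_mxEdr mxE mul0r sub0r.
case: (split_ordP J) => j ->; case: (split_ordP K) => k ->.
- rewrite partial_levi_civita_fibre_lower// row_mxEl !block_mxEul !mxE curvature_dconn.
  under eq_bigr do rewrite !block_mxEul block_mxEdl !mxE mulr0 subr0.
  under [X in _ + (_ + X)]eq_bigr do rewrite block_mxEur block_mxEdl !mxE.
  rewrite (dconn_torsion_free x l i j k) // (dconn_torsion_free x j i k l) //.
  rewrite (dconn_torsion_free x k i j l) //.
  (* The quadratic terms agree summand by summand. *)
  have <- : \sum_p (- G a x i p l * G a x p j k) + \sum_p - (- G a x p j l * - G a x i k p)
    + 2 * \sum_d G a x i l d * G a x d j k =
    \sum_p (G a x i l p * G a x p k j - G a x i k p * G a x p l j).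
    rewrite mulr_sumr -!big_split /=; apply: eq_bigr => p _.
    by rewrite (tfG _ _ ax i p l) (tfG _ _ ax p k j) (tfG _ _ ax p l j); ring.
  by ring.
- rewrite partial_levi_civita_fibre_lower// row_mxEr !block_mxEur !mxE subr0 add0r.
  rewrite !big1 ?addr0// => p _.
    by rewrite block_mxEdr block_mxEur !mxE mulr0 oppr0.
  by rewrite !block_mxEur block_mxEdr !mxE mulr0 sub0r mulr0 oppr0.
- rewrite partial_fibre_levi_civita_fibre// !block_mxEdl !mxE subrr add0r.
  rewrite !big1 ?addr0// => p _.
    by rewrite block_mxEdr !mxE mul0r oppr0.
  by rewrite !block_mxEdl !mxE mulr0 mulr0 subr0.
- rewrite partial_fibre_levi_civita_fibre// !block_mxEdr !mxE subrr add0r.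
  rewrite !big1 ?addr0// => p _.
    by rewrite block_mxEdr !mxE mul0r oppr0.
  by rewrite ?(block_mxEdr, block_mxEdl) !mxE !mulr0 subr0.
Qed.

(** Tracing over base indices gives the Ricci tensor of the connection, tracing
    over fibre indices gives its transpose. *)
Lemma ricci_extension x w : cdom a x ->
  ricci g a (row_mx x w) =
  block_mx (ricci_of G a x + (ricci_of G a x)^T) 0 0 (0 : 'M[R]_n).
Proof.
move=> ax; apply/matrixP => J K; rewrite [LHS]mxE big_split_ord /=.
under eq_bigr do rewrite curvature_extension_base//.
under [X in _ + X]eq_bigr do rewrite curvature_extension_fibre//.
case: (split_ordP J) => j ->; case: (split_ordP K) => k ->.
- rewrite block_mxEul !mxE; congr (_ + _); apply: eq_bigr => i _;
  by rewrite block_mxEul mxE.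
- by rewrite block_mxEur !mxE !big1 ?addr0// => i _; rewrite block_mxEur mxE.
- by rewrite block_mxEdl !mxE !big1 ?addr0// => i _; rewrite block_mxEdl mxE.
- by rewrite block_mxEdr !mxE !big1 ?addr0// => i _; rewrite block_mxEdr mxE.
Qed.

(** The metric determines the connection, by its slope along the fibre; the
    unknown tensor c cancels in the difference. *)
Lemma extension_fibre_slope x l i j : cdom a x ->
  g a (row_mx x (delta_mx 0 l)) (lshift n i) (lshift n j)
  - g a (row_mx x 0) (lshift n i) (lshift n j) = - 2 * G a x l i j.
Proof.
move=> ax; rewrite !extension_row_mx// !block_mxEul.
have := base_block_fibre_step x 0 l 1 i j; rewrite scale1r addr0 => ->.
by rewrite mul1r addrC addKr.
Qed.

End RicciExtension.

(** * Stationarity under the flow *)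

Section Evolution.
Local Open Scope classical_set_scope.
Local Open Scope ring_scope.
Context {R : realType}.

(** The connections at different times are unrelated a priori; they are compared
    through the metric components, which are differentiable in time. *)
Lemma ricci_flow_extension_stationary (n : nat) (X : coords R n) (I : set R)
    (gbar : R -> components02 (cotangent X)) :
  (forall a : cidx X, open (cdom a)) -> is_interval I -> ricci_flow I gbar ->
  (forall t, I t -> is_modified_riemann_extension (gbar t)) ->
  forall s t, I s -> I t -> forall (a : cidx (cotangent X)) z, cdom a z ->
  ricci (gbar s) a z = ricci (gbar t) a z.
Proof.
move=> openX itvI [_ _ flow] ext s t Is It a z.
rewrite -(hsubmxK z) /= row_mxKl; set x := lsubmx z; set w := rsubmx z => ax.
have data r : I r -> exists G : coefficients X,
    (forall y : 'rV[R]_n, @cdom R n X a y -> forall l i j : 'I_n,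
      gbar r a (row_mx y (delta_mx 0 l)) (lshift n i) (lshift n j)
      - gbar r a (row_mx y 0) (lshift n i) (lshift n j) = - 2 * G a y l i j) /\
    (forall y v : 'rV[R]_n, @cdom R n X a y -> ricci (gbar r) a (row_mx y v) =
      block_mx (ricci_of G a y + (ricci_of G a y)^T) 0 0 (0 : 'M[R]_n)).
  move=> Ir; have [G [c [[smG _] tfG [smc _] _ gE]]] := ext r Ir.
  have dG b y l i j v : cdom b y -> derivable ((fun u => G b u l i j) : _ -> R^o) y v.
    exact: smooth_derivable.
  have dc b y i j v : cdom b y -> derivable ((fun u => c b u i j) : _ -> R^o) y v.
    exact: (smooth_derivable _ _ _ _ _ (smc b i j)).
  exists G; split => [y ay l i j|y v ay]; first exact: extension_fibre_slope gE _ _ _ _ _ _.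
  exact: (ricci_extension G c).
have [Gs [slope_s ric_s]] := data s Is.
have [Gt [slope_t ric_t]] := data t It.
rewrite ric_s// ric_t//.
suff GE y : @cdom R n X a y -> forall l i j, Gs a y l i j = Gt a y l i j.
  by rewrite (ricci_of_local _ _ Gs Gt a (openX a)).
move=> ay l i j; apply: (@mulfI _ (-2)); first by rewrite oppr_eq0 pnatr_eq0.
rewrite -slope_s// -slope_t//.
apply: (derivative_within_eq0_cst I (fun r =>
  gbar r a (row_mx y (delta_mx 0 l)) (lshift n i) (lshift n j)
  - gbar r a (row_mx y 0) (lshift n i) (lshift n j))) => // r Ir.
have [Gr [_ ric_r]] := data r Ir.
have ricE : ricci (gbar r) a (row_mx y (delta_mx 0 l)) = ricci (gbar r) a (row_mx y 0).
  by rewrite !ric_r.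
have ayv v : @cdom R (n + n) (cotangent X) a (row_mx y v) by rewrite /= row_mxKl.
have d v := flow r Ir a (row_mx y v) (ayv v) (lshift n i) (lshift n j).
rewrite -(subrr (- 2 * ricci (gbar r) a (row_mx y 0) (lshift n i) (lshift n j))).
apply: derivative_within_sub; last exact: d.
by rewrite -ricE; exact: d.
Qed.

End Evolution.

Theorem theorem3 (R : realType) (n : nat) (M : topologicalType) (A : atlas R n M)
    (I : set R) (gbar : R -> components02 (cotangent (coords_of A)))
    (hM : smooth_manifold A)
    (hI : is_interval I)
    (hflow : ricci_flow I gbar)
    (hext : forall t, I t -> is_modified_riemann_extension (gbar t)) :
  forall s t, I s -> I t ->
  forall (a : cidx (cotangent (coords_of A))) z, cdom a z ->
    ricci (gbar s) a z = ricci (gbar t) a z.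
Proof.
apply: ricci_flow_extension_stationary => // a.
by case: hM => _ _ _ charts _; case: (charts a).
Qed.
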